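(* Let $c=(c_1,\dots,c_k)$ be a composition of $n$ (positive integers with $c_1+\cdots+c_k=n$). Then: (1) $g_{\bar c}(q)=q^n g_c(1/q)$, where $\bar c=(c_k,\dots,c_1)$ is the reverse of $c$; (2) $g_{mc}(q)=\frac{1}{m^k}g_c(q^m)$ for every positive integer $m$, where $mc=(mc_1,\dots,mc_k)$; (3) $g_c(q)=(1-q)^k f_c(q)$ for a polynomial $f_c(q)$ of degree $n-k$ with $f_c(1)\neq 0$; (4) $f_c(1)=1/k!$.
   Context: For a composition $c=(c_1,\dots,c_k)$, the composition polynomial is \[ g_c(q) := \int_{q}^{1} \int_{q}^{t_k} \cdots \int_{q}^{t_2} t_1^{c_1-1}\cdots t_k^{c_k-1}\, dt_1\cdots dt_k , \] and the reduced composition polynomial is $f_c(q)=g_c(q)/(1-q)^k$.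
   Formalization: Part (1) is proved with a sign, g_{\bar c}(q) = (-1)^k q^n g_c(1/q), since the printed identity fails for odd k: for c=(1), g_c(q)=1-q but q g_c(1/q)=q-1; for even k the two agree. *)

(* Defs.v *)
From mathcomp Require Import all_boot all_order all_algebra.
From mathcomp Require Import all_classical all_reals all_analysis.

Set Implicit Arguments.
Unset Strict Implicit.
Unset Printing Implicit Defensive.

Import Order.TTheory GRing.Theory Num.Theory.
Local Open Scope classical_set_scope.
Local Open Scope ring_scope.

Definition is_composition (n : nat) (c : seq nat) : bool :=
  all (leq 1) c && (sumn c == n).

(* The Lebesgue integral over `[a, b] is 0 when b < a; the integral from a to b
   has to change sign instead, since g_c(q) is used on both sides of q = 1. *)
Definition oint (R : realType) (a b : R) (f : R -> R) : R :=
  if a <= b then \int[lebesgue_measure]_(x in `[a, b]) f x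
  else - \int[lebesgue_measure]_(x in `[b, a]) f x.

(* s lists the exponents from the outermost variable to the innermost one, t is
   the upper bound of the outermost integral, and w accumulates the monomial in
   the variables already bound, so that the whole product
   t_1^(c_1-1) ... t_k^(c_k-1) is the integrand of the innermost integral. *)
Fixpoint iterated_oint (R : realType) (q t w : R) (s : seq nat) : R :=
  if s is a :: s' then
    oint q t (fun u => iterated_oint q u (u ^+ a.-1 * w) s')
  else w.

(* g_c(q). The outermost variable t_k carries the last part of c. For c = (1)
   this is 1 - q, also for q > 1: hence reversal, which replaces q by 1/q,
   involves the sign (-1)^k. *)
Definition composition_poly (R : realType) (c : seq nat) (q : R) : R :=
  iterated_oint q 1 1 (rev c).

(* f_c(q); meaningful for q != 1 only, the division returns 0 at q = 1. *)
Definition reduced_composition_poly (R : realType) (c : seq nat) (q : R) : R :=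
  composition_poly c q / (1 - q) ^+ size c.

(* Main.v *)
(** Splitting the path from [q] to [t] at [0] (Chen's formula for iterated
    integrals) gives the closed form
    [sum_j (-1)^j q^(c_1+...+c_j) t^(c_(j+1)+...+c_k) / (A_j B_j)],
    where [A_j = c_j (c_j + c_(j-1)) ... (c_j + ... + c_1)] and
    [B_j = c_(j+1) (c_(j+1) + c_(j+2)) ... (c_(j+1) + ... + c_k)].
    It is confirmed by induction: its derivative in [t] is [t^(c_k-1)] times the
    form for [c] without its last part, and it vanishes at [t = q]. At [t = 1]
    it yields the reversal and scaling rules term by term and shows that the
    degree is [n]. Finally, the derivative of [g_c] is [- q^(c_1-1) g_c'] with
    [c' = (c_2, ..., c_k)], so each part raises the multiplicity of the root
    [1] by one and divides the cofactor at [1] by [k]. *)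

Require Import Defs.
From mathcomp Require Import all_boot all_order all_algebra.
From mathcomp Require Import all_classical all_reals all_analysis.

Import Order.TTheory GRing.Theory Num.Theory.
Import numFieldNormedType.Exports.
Local Open Scope ring_scope.

(** * Sums of parts and products of such sums *)

Fixpoint suffix_sums_prod (c : seq nat) : nat :=
  if c is a :: c' then ((a + sumn c') * suffix_sums_prod c')%N else 1%N.

Lemma suffix_sums_prod_gt0 (c : seq nat) :
  all (leq 1) c -> (0 < suffix_sums_prod c)%N.
Proof.
elim: c => //= a c IH /andP[a0 /IH c0].
by rewrite muln_gt0 c0 addn_gt0 a0.
Qed.

Lemma sumn_map_muln (m : nat) (c : seq nat) :
  sumn (map (muln m) c) = (m * sumn c)%N.
Proof. by rewrite !sumnE big_map big_distrr. Qed.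

Lemma suffix_sums_prod_mul (m : nat) (c : seq nat) :
  suffix_sums_prod (map (muln m) c) = (m ^ size c * suffix_sums_prod c)%N.
Proof.
by elim: c => //= a c ->; rewrite sumn_map_muln -mulnDr expnS mulnACA.
Qed.

Lemma size_le_sumn (c : seq nat) : all (leq 1) c -> (size c <= sumn c)%N.
Proof. by elim: c => //= a c IH /andP[a0 /IH]; rewrite -add1n; exact: leq_add. Qed.

Lemma sumn_take_drop (j : nat) (c : seq nat) :
  (sumn (take j c) + sumn (drop j c))%N = sumn c.
Proof. by rewrite -sumn_cat cat_take_drop. Qed.

(** * Coefficients of the closed form *)

Section SplitCoef.
Variable R : numFieldType.

(** This is [(-1)^j / (A_j B_j)]: reversing [drop j c] makes the second product run over the sums
    that start at [c_(j+1)]. *)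
Definition split_coef (c : seq nat) (j : nat) : R :=
  (-1) ^+ j / (suffix_sums_prod (take j c) *
               suffix_sums_prod (rev (drop j c)))%:R.

(** A new first part adds the single factor [a + sumn (take j c)] to the first product, keeps the
    second and flips the sign. *)
Lemma split_coef_cons (a : nat) (c : seq nat) (j : nat) : (0 < a)%N ->
  split_coef (a :: c) j.+1 * (a + sumn (take j c))%:R = - split_coef c j.
Proof.
move=> a0; rewrite /split_coef /= exprS mulN1r -mulnA natrM invfM.
rewrite mulrA mulrAC mulfVK ?mulNr //.
by rewrite pnatr_eq0 -lt0n addn_gt0 a0.
Qed.

Lemma split_coef_rcons (a : nat) (c : seq nat) (j : nat) :
  (0 < a)%N -> (j <= size c)%N ->
  split_coef (rcons c a) j * (a + sumn (drop j c))%:R = split_coef c j.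
Proof.
move=> a0 jc; rewrite /split_coef drop_rcons // rev_rcons -cats1 takel_cat //=.
rewrite sumn_rev mulnCA natrM invfM mulrA mulrAC mulfVK //.
by rewrite pnatr_eq0 -lt0n addn_gt0 a0.
Qed.

Lemma split_coef_neq0 (c : seq nat) (j : nat) :
  all (leq 1) c -> split_coef c j != 0.
Proof.
move=> c1; rewrite mulf_neq0 ?signr_eq0 // invr_eq0 pnatr_eq0 -lt0n muln_gt0.
move: c1; rewrite -{1}(cat_take_drop j c) all_cat => /andP[ct cd].
by rewrite !suffix_sums_prod_gt0 // all_rev.
Qed.

(** Reversal exchanges the two products, hence the indices [j] and [size c - j]; only the parities
    of the signs remain to be compared. *)
Lemma split_coef_rev (c : seq nat) (j : nat) : (j <= size c)%N ->
  split_coef (rev c) j = (-1) ^+ size c * split_coef c (size c - j).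
Proof.
move=> jc; rewrite /split_coef take_rev drop_rev revK mulnC mulrA -exprD.
congr (_ / _); rewrite -signr_odd -[RHS]signr_odd; congr (_ ^+ _).
by rewrite oddD oddB // addKb.
Qed.

Lemma split_coef_mul (m : nat) (c : seq nat) (j : nat) : (j <= size c)%N ->
  split_coef (map (muln m) c) j = (m%:R ^+ size c)^-1 * split_coef c j.
Proof.
move=> jc; rewrite /split_coef -map_take -map_drop -map_rev.
rewrite !suffix_sums_prod_mul size_rev mulnACA -expnD -size_cat cat_take_drop.
by rewrite natrM invfM natrX mulrCA.
Qed.

(* Multiplying by [sumn c = sumn (take j c) + sumn (drop j c)] cancels the
   largest factor of one of the two products, so that the sum for [c] becomes
   the difference of the sums for [c] without its last and without its first
   part. *)
Lemma sum_split_coef (c : seq nat) : all (leq 1) c ->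
  \sum_(j < (size c).+1) split_coef c j = (size c == 0)%:R.
Proof.
move sm : (size c) => m; elim: m c sm => [|m IH] c.
  by move=> /size0nil -> _; rewrite big_ord1 /split_coef /= divr1.
move=> sc c1; set S := \sum_(_ < _) _.
have S1 : S * (sumn c)%:R = \sum_(j < m.+2) split_coef c j * (sumn (take j c))%:R
     + \sum_(j < m.+2) split_coef c j * (sumn (drop j c))%:R.
  rewrite /S mulr_suml -big_split /=; apply: eq_bigr => j _.
  by rewrite -mulrDr -natrD sumn_take_drop.
have cn0 : (sumn c)%:R != 0 :> R.
  by rewrite pnatr_eq0 -lt0n (leq_trans _ (@size_le_sumn _ c1)) // sc.
suff : S * (sumn c)%:R = 0.
  by move=> /eqP; rewrite mulf_eq0 (negbTE cn0) orbF => /eqP.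
rewrite S1 big_ord_recl take0 mulr0 add0r.
case: c sc c1 {S S1 cn0} => // a c [sc] /andP[a0 c1].
under eq_bigr => j _ do rewrite /= split_coef_cons //.
rewrite sumrN IH //.
(* The second sum still runs over [a :: c], reread as [rcons d b] to remove its last part. Up to
   sign both sums then equal [(m == 0)%:R], so they cancel for [m = 0] too. *)
have : all (leq 1) (a :: c) by apply/andP.
have : size (a :: c) = m.+1 by rewrite /= sc.
case/lastP: (a :: c) => // d b; rewrite size_rcons => -[sd].
rewrite all_rcons => /andP[b0 d1].
rewrite big_ord_recr /= drop_oversize ?size_rcons ?sd // mulr0 addr0.
under eq_bigr => j _.
  rewrite drop_rcons ?sd -1?ltnS // sumn_rcons addnC split_coef_rcons ?sd -1?ltnS //.
  over.
by rewrite IH // addNr.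
Qed.

(** The indeterminate is the upper bound [t], with [q] fixed. Each exponent brought down cancels the
    largest factor of [B_j]; the last term is constant. *)
Lemma deriv_sum_split_coef_rcons (a : nat) (c : seq nat) (q : R) : (0 < a)%N ->
  (\sum_(j < (size c).+2) (split_coef (rcons c a) j * q ^+ sumn (take j (rcons c a)))
      *: 'X^(sumn (drop j (rcons c a))))^`() =
  'X^(a.-1) * \sum_(j < (size c).+1) (split_coef c j * q ^+ sumn (take j c))
      *: 'X^(sumn (drop j c)).
Proof.
move=> a0; rewrite raddf_sum big_ord_recr /= drop_oversize ?size_rcons //.
rewrite expr0 derivZ derivC scaler0 addr0 mulr_sumr; apply: eq_bigr => j _.
have jc : (j <= size c)%N by rewrite -ltnS.
rewrite drop_rcons // sumn_rcons derivZ derivXn -cats1 takel_cat // cats1.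
rewrite addnC -scaler_nat scalerA mulrAC split_coef_rcons //.
by case: a a0 => // a _; rewrite addSn /= exprD scalerAr.
Qed.

(** * The closed form at [t = 1] as a polynomial in [q] *)

Definition split_poly (c : seq nat) : {poly R} :=
  \sum_(j < (size c).+1) split_coef c j *: 'X^(sumn (take j c)).

Lemma deriv_split_poly_cons (a : nat) (c : seq nat) : (0 < a)%N ->
  (split_poly (a :: c))^`() = - ('X^(a.-1) * split_poly c).
Proof.
move=> a0; rewrite /split_poly raddf_sum big_ord_recl /= expr0 derivZ derivC.
rewrite scaler0 add0r mulr_sumr -sumrN; apply: eq_bigr => j _.
rewrite derivZ derivXn -scaler_nat scalerA split_coef_cons // scaleNr.
by case: a a0 => // a _; rewrite addSn /= exprD scalerAr.
Qed.

Lemma split_poly1 (c : seq nat) : all (leq 1) c ->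
  (split_poly c).[1] = (size c == 0)%:R.
Proof.
move=> c1; rewrite -sum_split_coef // /split_poly horner_sum.
by apply: eq_bigr => j _; rewrite !hornerE expr1n mulr1.
Qed.

(** Parts are positive, so the exponent [sumn c] occurs only in the last term, whose coefficient is
    nonzero. *)
Lemma size_split_poly (c : seq nat) : all (leq 1) c ->
  size (split_poly c) = (sumn c).+1.
Proof.
move=> c1; rewrite /split_poly big_ord_recr /= take_size addrC.
have sz : size (split_coef c (size c) *: 'X^(sumn c)) = (sumn c).+1.
  by rewrite size_scale ?size_polyXn // split_coef_neq0.
rewrite size_polyDl sz // ltnS; apply: leq_trans (size_sum _ _ _) _.
apply/bigmax_leqP => j _; apply: leq_trans (size_scale_leq _ _) _.
rewrite size_polyXn -(sumn_take_drop j c) -addn1 leq_add2l.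
rewrite (leq_trans _ (@size_le_sumn _ _)) ?size_drop ?subn_gt0 //.
by move: c1; rewrite -{1}(cat_take_drop j c) all_cat => /andP[].
Qed.

(** A sum of last parts of [c] is [sumn c] minus a sum of first parts; this produces the power of
    [q] and the argument [q^-1]. *)
Lemma horner_split_poly_rev (c : seq nat) (q : R) : q != 0 ->
  (split_poly (rev c)).[q] =
    (-1) ^+ size c * (q ^+ sumn c * (split_poly c).[q^-1]).
Proof.
move=> q0; rewrite /split_poly !horner_sum !mulr_sumr size_rev.
rewrite (reindex_inj rev_ord_inj); apply: eq_bigr => j _ /=.
have jc : (j <= size c)%N by rewrite -ltnS.
rewrite subSS split_coef_rev ?leq_subr // subKn // !hornerZ !hornerXn -mulrA.
congr (_ * _); rewrite mulrCA; congr (_ * _).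
rewrite take_rev sumn_rev subKn // -(sumn_take_drop j c) exprD exprVn.
by rewrite mulrAC divff ?mul1r // expf_neq0.
Qed.

Lemma horner_split_poly_mul (m : nat) (c : seq nat) (q : R) :
  (split_poly (map (muln m) c)).[q] =
    (m%:R ^+ size c)^-1 * (split_poly c).[q ^+ m].
Proof.
rewrite /split_poly !horner_sum size_map mulr_sumr; apply: eq_bigr => j _.
rewrite !hornerZ !hornerXn split_coef_mul -1?ltnS // -mulrA -exprM.
by rewrite -map_take sumn_map_muln.
Qed.

End SplitCoef.

(** * Multiplicity of the root [1] *)

Lemma XsubC_exp_mul_inj (F : idomainType) (a : F) (i j : nat) (u v : {poly F}) :
  ~~ root u a -> ~~ root v a ->
  u * ('X - a%:P) ^+ i = v * ('X - a%:P) ^+ j -> i = j /\ u = v.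
Proof.
wlog ij : i j u v / (i <= j)%N.
  move=> H ua va; case/orP: (leq_total i j) => ij e; first exact: H.
  by have [-> ->] := H _ _ _ _ ij va ua (esym e).
move=> ua va; rewrite -(subnK ij) exprD mulrA => /(mulIf _) e.
have {}e : u = v * ('X - a%:P) ^+ (j - i).
  by apply: e; rewrite expf_neq0 // polyXsubC_eq0.
case E : (j - i)%N e => [|d] e; first by rewrite e expr0 mulr1.
by move: ua; rewrite e exprS !rootM root_XsubC eqxx orbT.
Qed.

Lemma root_deriv_factor (F : numFieldType) (a : F) (k : nat) (p u : {poly F}) :
  root p a -> ~~ root u a -> p^`() = u * ('X - a%:P) ^+ k ->
  exists2 r, p = r * ('X - a%:P) ^+ k.+1 & u.[a] = k.+1%:R * r.[a].
Proof.
move=> pa ua dp.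
have p0 : p != 0.
  apply: contraNneq ua => p0; move: dp; rewrite p0 deriv0 => /esym/eqP.
  by rewrite mulf_eq0 expf_eq0 polyXsubC_eq0 andbF orbF => /eqP ->; rewrite root0.
have [[|j] [r]] := multiplicity_XsubC p a; rewrite p0 /= => ra pr.
  by move: pa; rewrite pr expr0 mulr1 (negbTE ra).
pose v := r^`() * ('X - a%:P) + j.+1%:R *: r.
have va : v.[a] = j.+1%:R * r.[a] by rewrite !hornerE subrr mulr0 add0r.
have dv : p^`() = v * ('X - a%:P) ^+ j.
  rewrite pr derivM deriv_exp derivXsubC mul1r /= exprS mulrA mulrDl.
  by rewrite scaler_nat mulrnAl mulrnAr.
have nva : ~~ root v a.
  by rewrite rootE va mulf_neq0 // pnatr_eq0.
have [ekj uv] := XsubC_exp_mul_inj _ _ _ _ _ _ ua nva (etrans (esym dp) dv).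
by exists r; rewrite ?uv ekj.
Qed.

Lemma split_poly_factor (F : numFieldType) (c : seq nat) : all (leq 1) c ->
  exists2 f : {poly F}, split_poly F c = (1 - 'X) ^+ size c * f
    & f.[1] = ((size c)`!%:R)^-1.
Proof.
elim: c => [_|a c IH /andP[a0 c1]].
  exists 1; last by rewrite hornerE fact0 invr1.
  by rewrite /split_poly big_ord1 /split_coef /= divr1 scale1r expr0 mulr1.
have [f cf f1] := IH c1.
have sgn k : (1 - 'X : {poly F}) ^+ k = (-1) ^+ k *: ('X - 1%:P) ^+ k.
  by rewrite -opprB -scaleN1r exprZn.
(* The cofactor of [('X - 1) ^+ size c] in the derivative; its inner sign comes from replacing
   [1 - 'X] by ['X - 1]. *)
pose u := - ('X^(a.-1) * ((-1) ^+ size c *: f)).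
have u1 : u.[1] = (-1) ^+ (size c).+1 / (size c)`!%:R.
  by rewrite /u hornerN hornerM hornerXn hornerZ f1 expr1n mul1r exprS mulN1r mulNr.
have [|||r pr r1] := @root_deriv_factor F 1 (size c) (split_poly F (a :: c)) u.
- by rewrite rootE split_poly1 //= a0.
- by rewrite rootE u1 mulf_neq0 ?signr_eq0 // invr_eq0 pnatr_eq0 -lt0n fact_gt0.
- rewrite deriv_split_poly_cons // cf sgn /u mulNr -!scalerAl; congr (- _).
  by rewrite -!scalerAr -scalerAl mulrCA mulrC -mulrA [f * _]mulrC mulrA.
exists ((-1) ^+ (size c).+1 *: r).
  by rewrite pr /= sgn -scalerAl -scalerAr scalerA -exprMn mulrNN mulr1 expr1n
    scale1r mulrC.
rewrite hornerZ factS natrM invfM.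
have -> : r.[1] = (size c).+1%:R^-1 * u.[1] by rewrite r1 mulKf // pnatr_eq0.
by rewrite u1 mulrCA signrMK.
Qed.

(** * Evaluation of the iterated integral *)

Lemma oint_deriv (R : realType) (p : {poly R}) (a b : R) :
  oint a b (horner p^`()) = p.[b] - p.[a].
Proof.
have H x y : x < y -> \int[lebesgue_measure]_(u in `[x, y]) p^`().[u] = p.[y] - p.[x].
  move=> xy; rewrite /Rintegral (@continuous_FTC2 _ (horner p^`()) (horner p)) //.
  - by apply/continuous_subspaceT => z; exact: continuous_horner.
  - split.
    + by move=> z _; exact: derivable_horner.
    + by apply: cvg_at_right_filter; exact: continuous_horner.
    + by apply: cvg_at_left_filter; exact: continuous_horner.
  - by move=> z _; rewrite derivE.
rewrite /oint; case: ltgtP => ab; first exact: H.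
  by rewrite H // opprB.
by rewrite ab set_itv1 Rintegral_set1 subrr.
Qed.

Lemma iterated_ointE (R : realType) (q t w : R) (s : seq nat) :
  all (leq 1) s ->
  iterated_oint q t w s = w * \sum_(j < (size s).+1)
    split_coef R (rev s) j * q ^+ sumn (take j (rev s))
      * t ^+ sumn (drop j (rev s)).
Proof.
elim: s t w => [|a s IH] t w.
  by move=> _; rewrite big_ord1 /split_coef /= divr1 !mulr1.
move=> /= /andP[a0 s1].
(* The closed form as a polynomial in [t]: [w *: P] is an antiderivative of the outermost
   integrand. *)
pose P := \sum_(j < (size s).+2) (split_coef R (rcons (rev s) a) j
  * q ^+ sumn (take j (rcons (rev s) a))) *: 'X^(sumn (drop j (rcons (rev s) a))).
have PE x : P.[x] = \sum_(j < (size s).+2) split_coef R (rcons (rev s) a) j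
  * q ^+ sumn (take j (rcons (rev s) a)) * x ^+ sumn (drop j (rcons (rev s) a)).
  by rewrite /P horner_sum; apply: eq_bigr => j _; rewrite !hornerE.
have -> : (fun u => iterated_oint q u (u ^+ a.-1 * w) s) = horner (w *: P)^`().
  apply/funext => u; rewrite IH // derivZ /P -(size_rev s).
  rewrite deriv_sum_split_coef_rcons // hornerZ hornerM hornerXn.
  rewrite -mulrA mulrCA; congr (w * (_ * _)).
  by rewrite horner_sum; apply: eq_bigr => j _; rewrite !hornerE.
rewrite oint_deriv !hornerZ -mulrBr rev_cons -PE; congr (w * _).
(* At [t = q] every term carries the same power of [q], and the coefficients sum to zero. *)
suff -> : P.[q] = 0 by rewrite subr0.
rewrite PE; under eq_bigr => j _ do
  rewrite -mulrA -exprD sumn_take_drop.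
rewrite -mulr_suml -(size_rev s) -(size_rcons (rev s) a) sum_split_coef.
  by rewrite size_rcons mul0r.
by rewrite all_rcons a0 all_rev.
Qed.

Lemma composition_polyE (R : realType) (c : seq nat) (q : R) :
  all (leq 1) c -> composition_poly c q = (split_poly R c).[q].
Proof.
move=> c1; rewrite /composition_poly iterated_ointE ?all_rev // revK size_rev.
rewrite mul1r /split_poly horner_sum; apply: eq_bigr => j _.
by rewrite !hornerE expr1n mulr1.
Qed.

(** * Reversal, scaling, factorization and degree *)

Theorem theorem6p4 (R : realType) (n k : nat) (c : k.-tuple nat)
    (hc : is_composition n c) :
  [/\ forall q : R, q != 0 ->
        composition_poly (rev c) q = (-1) ^+ k * (q ^+ n * composition_poly c q^-1),
      forall (m : nat) (q : R), (0 < m)%N ->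
        composition_poly (map (muln m) c) q
          = (m%:R ^+ k)^-1 * composition_poly c (q ^+ m)
    & exists f : {poly R},
        [/\ forall q : R, q != 1 -> f.[q] = reduced_composition_poly c q,
            forall q : R, composition_poly c q = (1 - q) ^+ k * f.[q],
            size f = (n - k).+1,
            f.[1] != 0
          & f.[1] = (k`!%:R)^-1]].
Proof.
case/andP: hc => c1 /eqP <-.
have sc : size c = k by rewrite size_tuple.
split=> [q q0|m q m0|].
- by rewrite !composition_polyE ?all_rev // horner_split_poly_rev // sc.
- rewrite !composition_polyE // ?horner_split_poly_mul ?sc //.
  by rewrite all_map; apply: sub_all c1 => a /= a0; rewrite muln_gt0 m0.
have [f cf f1] := split_poly_factor R c c1; rewrite sc in cf f1.
have gE q : composition_poly c q = (1 - q) ^+ k * f.[q].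
  by rewrite composition_polyE // cf !hornerE.
have f10 : f.[1] != 0 by rewrite f1 invr_eq0 pnatr_eq0 -lt0n fact_gt0.
exists f; split=> // [q q1|].
  rewrite /reduced_composition_poly gE sc mulrAC divff ?mul1r //.
  by rewrite expf_neq0 // subr_eq0 eq_sym.
have f0 : f != 0 by apply: contraNneq f10 => ->; rewrite horner0.
have := size_split_poly R c c1.
rewrite cf -opprB -scaleN1r exprZn -scalerAl size_scale ?signr_eq0 //.
rewrite mulrC size_Mmonic ?monic_exp ?monicXsubC // size_exp_XsubC addnS /=.
(* [size] is the degree plus one, and the truncated [n - k] is a true difference because
   [k <= n]. *)
move=> sf; rewrite -subSn -?sf ?addnK //.
by move: (@size_le_sumn _ c1); rewrite sc.
Qed.
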